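(* Let $P\subseteq\mathbb{R}^n\times\mathbb{R}^d$ be a polytope and let $p_x:\mathbb{R}^n\times\mathbb{R}^d\to\mathbb{R}^n$ be the projection onto the first $n$ coordinates. The pair $(P,p_x)$ has the PF-property if and only if for every $S\subseteq\operatorname{vert}(p_x(P))$ the following holds: $$\operatorname{conv}\{v\in\operatorname{vert}(P) : p_x(v)\in S\}=\{v\in P : p_x(v)\in\operatorname{conv}(S)\},$$ i.e. the pair $(P,p_x)$ has the PF-property if and only if for every $S\subseteq\operatorname{vert}(p_x(P))$ $$p_x^{-1}(\operatorname{conv}(S))\cap P=\operatorname{conv}\bigl(p_x^{-1}(S)\cap\operatorname{vert}(P)\bigr).$$
   Context: A polytope is the convex hull of a finite set of points; $\operatorname{vert}(P)$ denotes the vertex set of a polytope $P$ and $\operatorname{conv}$ denotes the convex hull. Faces of a polytope include the polytope itself (and the empty set is also regarded as a face). The projection $p_x(P)=\{x\in\mathbb{R}^n : \exists y\in\mathbb{R}^d \text{ with } (x,y)\in P\}$ is a polytope. A polytope $P\subseteq\mathbb{R}^n\times\mathbb{R}^d$ together with the projection map $p_x:\mathbb{R}^n\times\mathbb{R}^d\to\mathbb{R}^n$, $(x,y)\mapsto x$, has the PF-property (projected faces property) if for every face $F$ of $P$ the projection $p_x(F)$ is a face of the polytope $p_x(P)$. *)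

(* Defs.v *)
From mathcomp Require Import all_boot all_order all_algebra.
From mathcomp Require Import boolp classical_sets functions cardinality reals convex.

Set Implicit Arguments.
Unset Strict Implicit.
Unset Printing Implicit Defensive.

Import Order.TTheory GRing.Theory Num.Theory.

Local Open Scope classical_set_scope.
Local Open Scope ring_scope.

Definition conv_hull (R : realType) (V : lmodType R) (A : set V) : set V :=
  smallest (@convex_set R V) A.

Definition is_polytope (R : realType) (V : lmodType R) (P : set V) : Prop :=
  exists2 A : set V, finite_set A & P = conv_hull A.

(* A face is cut out by a valid linear inequality [c x <= b]; taking [c = 0]
   with [b = 0], resp. [b = 1], shows that [P] itself, resp. [set0], is a
   face. *)
Definition is_face (R : realType) (V : lmodType R) (P F : set V) : Prop :=
  exists (c : {scalar V}) (b : R),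
    (forall x, P x -> c x <= b) /\ F = P `&` [set x | c x = b].

Definition vert (R : realType) (V : lmodType R) (P : set V) : set V :=
  [set v | is_face P [set v]].

Definition p_x (R : realType) (n d : nat) (v : 'rV[R]_n * 'rV[R]_d) : 'rV[R]_n :=
  v.1.
Arguments p_x {R n d} v.

Definition PF_property (R : realType) (n d : nat)
    (P : set ('rV[R]_n * 'rV[R]_d)) : Prop :=
  forall F, is_face P F -> is_face (p_x @` P) (p_x @` F).

(* Main.v *)
(* Let [Q] be the image of [P] under the projection [f].
   If faces project to faces, take [v] in [P] above [conv S] but outside the
   hull [K] of the vertices above [S], and separate it from [K] by [c].  Let [u]
   maximize [c] on the fibre of [f v], and let [F] be the smallest face
   containing [u].  Since [f @` F] is a face of [Q], [f v] is a combination of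
   points of [S] lying in [f @` F], so some [w] in [F] and [K] lies above [f v];
   moving from [u] away from [w] stays in [P] and in the fibre, and increases
   [c].
   Conversely, let [y] be a relative interior point of a face [F] and [G] the
   smallest face of [Q] containing [f y]; then [f @` F] lies in [G].  For a vertex
   [t] of [G], follow the line from [t] through [f y] until it leaves [Q], in a
   face [H] containing neither [t] nor [f y].  By the fibre condition for [t] and
   the vertices of [H], [y] is a combination of vertices of [F] above these; they
   cannot all lie above [H], so [t] is in [f @` F]. *)
Require Import Defs.
From HB Require Import structures.
From mathcomp Require Import all_boot all_order all_algebra.
From mathcomp Require Import boolp classical_sets functions cardinality reals convex.
From mathcomp Require Import interval_inference ring lra.

Set Implicit Arguments.
Unset Strict Implicit.
Unset Printing Implicit Defensive.

Import Order.TTheory GRing.Theory Num.Theory VectorInternalTheory.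

Local Open Scope classical_set_scope.
Local Open Scope ring_scope.

(** * Convexity with real weights, linear forms, coordinates *)

Lemma convex_setP (R : realType) (V : lmodType R) (A : set V) :
  @convex_set R V A <->
  forall x y (t : R), 0 < t -> t < 1 -> A x -> A y -> A (t *: x + (1 - t) *: y).
Proof.
split=> [/convex_setW cA x y t t0 t1 Ax Ay|cA].
  have t01 : Itv.spec (@Itv.num_sem R) (Itv.Real `[0%Z, 1%Z]) t.
    by rewrite /= /Itv.num_sem/= in_itv/= (ltW t0) (ltW t1) ger0_real ?ltW.
  have := cA x y; rewrite !inE => /(_ Ax Ay (Itv.mk t01) t0 t1).
  by rewrite inE.
apply/convex_setW => x y /set_mem Ax /set_mem Ay k k0 k1.
by apply/mem_set; exact: cA.
Qed.

Lemma scalar_ex (R : realType) (V : lmodType R) (f : V -> R) :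
  scalar f -> exists c : {scalar V}, c =1 f.
Proof.
move=> lf; pose m := GRing.isLinear.Build R V R *%R f lf.
by exists (HB.pack_for {scalar V} f m).
Qed.

(** Turns an identity between vectors into one between real coordinates, where [ring] and [field]
    apply. *)
Ltac vect_coord :=
  apply: v2r_inj; apply/rowP=> ?;
  rewrite !(linearD, linearN, linearZ, linear0) /= !mxE.

(** * Convex cones and Farkas' lemma *)

Definition convex_cone (R : realType) (V : lmodType R) (D : set V) :=
  [/\ D 0, forall x y, D x -> D y -> D (x + y) &
      forall (r : R) x, 0 <= r -> D x -> D (r *: x)].

(* Bartl's induction: if [x0] separates [s] from [g] but is positive on [a],
   project along [a] onto the kernel of [x0] and separate the images. *)
Lemma farkas (R : realType) (V : vectType R) (D : set V) (s : seq V) (g : V) :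
    convex_cone D -> {in s, forall a, D a} -> ~ D g ->
  exists2 c : {scalar V}, {in s, forall a, c a <= 0} & 0 < c g.
Proof.
move=> [D0 DD DZ]; have [n] := ubnP (size s).
elim: n s g => // n IH [|a s] g /= sn sD nDg.
  (* With no generators left, [g] is nonzero because [D 0] holds. A coordinate form scaled by the
     entry of [g] at that coordinate takes a square as its value at [g]. *)
  have : v2r g != 0.
    apply: contra_notN nDg => /eqP g0; rewrite (_ : g = 0) //.
    by apply: v2r_inj; rewrite g0 linear0.
  case/rV0Pn=> i gi.
  have [|c cE] := @scalar_ex R V (fun v => v2r g 0 i * v2r v 0 i).
    by move=> k x y /=; rewrite linearP !mxE; ring.
  by exists c => //; rewrite cE -expr2 exprn_even_gt0.
have sD' : {in s, forall b, D b} by move=> b bs; apply: sD; rewrite inE bs orbT.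
have Da : D a by apply: sD; rewrite inE eqxx.
have [x0 x0s x0g] := IH s g sn sD' nDg.
have [x0a|x0a] := leP (x0 a) 0.
  by exists x0 => // b; rewrite inE => /predU1P[->|/x0s].
pose u v := v - (x0 v / x0 a) *: a.
have [|||c cs cg] := IH (map u s) (u g).
- by rewrite size_map.
- move=> _ /mapP[b bs ->]; rewrite /u -scaleNr; apply: DD (sD' _ bs) _.
  by apply: DZ Da; rewrite -mulNr divr_ge0 ?oppr_ge0 ?x0s ?ltW.
- move=> Du; apply: nDg; rewrite -(subrK ((x0 g / x0 a) *: a) g).
  by apply: DD Du _; apply: DZ Da; rewrite divr_ge0 ?ltW.
have [|e eE] := @scalar_ex R V (fun v => c (u v)).
  move=> k x y; rewrite /u linearP -[RHS](linearP c); congr (c _).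
  by rewrite scalerBr scalerA mulrDl scalerDl mulrA opprD addrACA.
exists e => [b|]; rewrite eE //.
rewrite inE => /predU1P[->|bs]; last by apply: cs; apply: map_f.
by rewrite /u divff ?gt_eqF // scale1r subrr linear0.
Qed.

(** * Convex hulls, faces and polytopes under linear maps *)

Lemma conv_hull_convex (R : realType) (V : lmodType R) (A : set V) :
  @convex_set R V (conv_hull A).
Proof.
apply/convex_setP => x y t t0 t1 Ax Ay B BP.
by have [/convex_setP cB _] := BP; exact: cB t0 t1 (Ax _ BP) (Ay _ BP).
Qed.

Lemma conv_hull_min (R : realType) (V : lmodType R) (A B : set V) :
  @convex_set R V B -> A `<=` B -> conv_hull A `<=` B.
Proof. exact: smallest_sub. Qed.

Lemma sub_conv_hull (R : realType) (V : lmodType R) (A : set V) :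
  A `<=` conv_hull A.
Proof. exact: sub_gen_smallest. Qed.

Lemma conv_hullS (R : realType) (V : lmodType R) (A B : set V) :
  A `<=` B -> conv_hull A `<=` conv_hull B.
Proof.
move=> AB; apply: conv_hull_min (@conv_hull_convex _ _ _) _.
exact: subset_trans (@sub_conv_hull _ _ _).
Qed.

Lemma convexI (R : realType) (V : lmodType R) (A B : set V) :
  @convex_set R V A -> @convex_set R V B -> @convex_set R V (A `&` B).
Proof.
move=> /convex_setP cA /convex_setP cB; apply/convex_setP=> x y t t0 t1.
by move=> [Ax Bx] [Ay By]; split; [apply: cA | apply: cB].
Qed.

Lemma convex_preimage (R : realType) (V U : lmodType R) (f : {linear V -> U})
    (A : set U) : @convex_set R U A -> @convex_set R V (f @^-1` A).
Proof.
move=> /convex_setP cA; apply/convex_setP=> x y t t0 t1 /= Ax Ay.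
by rewrite linearD !linearZ; apply: cA.
Qed.

Lemma convex_image (R : realType) (V U : lmodType R) (f : {linear V -> U})
    (A : set V) : @convex_set R V A -> @convex_set R U (f @` A).
Proof.
move=> /convex_setP cA; apply/convex_setP=> _ _ t t0 t1 [x Ax <-] [y Ay <-].
by exists (t *: x + (1 - t) *: y); [apply: cA | rewrite linearD !linearZ].
Qed.

Lemma image_conv_hull (R : realType) (V U : lmodType R) (f : {linear V -> U})
    (A : set V) : f @` conv_hull A = conv_hull (f @` A).
Proof.
apply/seteqP; split.
  move=> _ [x Ax <-]; suff : conv_hull A `<=` f @^-1` conv_hull (f @` A) by apply.
  apply: conv_hull_min.
    exact/convex_preimage/conv_hull_convex.
  by move=> y Ay; apply: sub_conv_hull; exists y.
apply: conv_hull_min; first exact/convex_image/conv_hull_convex.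
by move=> _ [x Ax <-]; exists x => //; exact: sub_conv_hull.
Qed.

Lemma convex_halfspace (R : realType) (V : lmodType R) (c : {scalar V}) (b : R) :
  @convex_set R V [set x | c x <= b].
Proof.
apply/convex_setP=> x y t t0 t1 /= xb yb; rewrite linearD !linearZ /=.
nra.
Qed.

Lemma convex_hyperplane (R : realType) (V : lmodType R) (c : {scalar V}) (b : R) :
  @convex_set R V [set x | c x = b].
Proof.
by apply/convex_setP=> x y t t0 t1 /= xb yb; rewrite linearD !linearZ /= xb yb; ring.
Qed.

(** In a combination with positive weights, a valid inequality can be tight only if it is tight at
    both ends. Hence the points that satisfy the inequality, and lie in the smaller hull whenever it
    is tight, form a convex set containing [A]. *)
Lemma conv_hull_face (R : realType) (V : lmodType R) (A : set V)
    (c : {scalar V}) (b : R) : (forall x, A x -> c x <= b) ->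
  conv_hull A `&` [set x | c x = b] `<=` conv_hull (A `&` [set x | c x = b]).
Proof.
move=> Ab x [Ax cx].
have : conv_hull A `<=`
    [set x | c x <= b /\ (c x = b -> conv_hull (A `&` [set x | c x = b]) x)].
  apply: conv_hull_min => [|y Ay]; last first.
    by split; [exact: Ab | move=> cy; exact: sub_conv_hull].
  apply/convex_setP=> y z t t0 t1 [yb cy] [zb cz].
  rewrite /= linearD !linearZ /=; split; first nra.
  move=> e; have /convex_setP := @conv_hull_convex _ _ (A `&` [set x | c x = b]).
  by apply=> //; [apply: cy; nra | apply: cz; nra].
by move=> /(_ _ Ax)[_]; apply.
Qed.

Lemma convex_face (R : realType) (V : lmodType R) (P F : set V) :
  @convex_set R V P -> is_face P F -> @convex_set R V F.
Proof.
by move=> cP [c [b [_ ->]]]; apply: convexI cP _; exact: convex_hyperplane.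
Qed.

Lemma face_sub (R : realType) (V : lmodType R) (P F : set V) :
  is_face P F -> F `<=` P.
Proof. by move=> [c [b [_ ->]]] x []. Qed.

(** The point [v] lies on the segment from [f] to [v + e *: (v - f)], short of the far end, so an
    inequality valid at both ends and tight at [v] is tight at [f]. *)
Lemma face_extremal (R : realType) (V : lmodType R) (P F : set V) (v f : V) (e : R) :
  is_face P F -> F v -> P f -> 0 < e -> P (v + e *: (v - f)) -> F f.
Proof.
move=> [c [b [Pb ->]]] [Pv cv] Pf e0 /Pb; rewrite linearD linearZ linearB /=.
by move=> le_b; split=> //=; have := Pb _ Pf; rewrite /= in cv; nra.
Qed.

Lemma polytope_convex (R : realType) (V : lmodType R) (P : set V) :
  is_polytope P -> @convex_set R V P.
Proof. by move=> [A _ ->]; exact: conv_hull_convex. Qed.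

Lemma polytope_image (R : realType) (V U : lmodType R) (f : {linear V -> U})
    (P : set V) : is_polytope P -> is_polytope (f @` P).
Proof.
move=> [A fA ->]; exists (f @` A); first exact: finite_image.
exact: image_conv_hull.
Qed.

Lemma polytope_bounded (R : realType) (V : lmodType R) (P : set V) (c : {scalar V}) :
  is_polytope P -> exists M, forall x, P x -> c x <= M.
Proof.
move=> [A /finite_seqP[s ->] ->].
suff [M sM] : exists M, {in s, forall x, c x <= M}.
  by exists M; apply: conv_hull_min sM; exact: convex_halfspace.
elim: s => [|a s [M sM]]; first by exists 0.
exists (Num.max (c a) M) => x; rewrite inE le_max => /predU1P[->|/sM ->].
  by rewrite lexx.
by rewrite orbT.
Qed.

(** * Feasible directions, separation and minimal faces *)

Lemma feasible_cone (R : realType) (V : vectType R) (P : set V) (v : V) :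
  @convex_set R V P -> P v ->
  convex_cone [set w | exists2 e : R, 0 < e & P (v + e *: w)].
Proof.
move=> /convex_setP cP Pv; split=> /= [|x y [e e0 Pe] [k k0 Pk]|r x].
- by exists 1; rewrite // scaler0 addr0.
- have ek : 0 < e + k by rewrite addr_gt0.
  (* This step length puts the new point on the segment between [v + e *: x] and [v + k *: y]. *)
  exists (e * k / (e + k)); first by rewrite divr_gt0 ?mulr_gt0.
  suff -> : v + (e * k / (e + k)) *: (x + y) =
      (k / (e + k)) *: (v + e *: x) + (1 - k / (e + k)) *: (v + k *: y).
    by apply: cP; rewrite ?divr_gt0 // ltr_pdivrMr // mul1r ltrDr.
  by vect_coord; field; rewrite gt_eqF.
- rewrite le_eqVlt => /predU1P[<-|r0] [e e0 Pe].
    by exists 1; rewrite // scale0r scaler0 addr0.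
  by exists (e / r); rewrite ?divr_gt0 // scalerA divfK ?gt_eqF.
Qed.

(** This is the cone over [P] placed at height 1, with its apex added; it lets Farkas' lemma, which
    is linear, separate points affinely. *)
Lemma homogeneous_cone (R : realType) (V : vectType R) (P : set V) :
  @convex_set R V P ->
  convex_cone [set w : V * R^o | w = 0 \/ 0 < w.2 /\ P (w.2^-1 *: w.1)].
Proof.
move=> /convex_setP cP.
have mean (x y : V) (r q : R) : 0 < r -> 0 < q -> (r + q)^-1 *: (x + y) =
    (r / (r + q)) *: (r^-1 *: x) + (1 - r / (r + q)) *: (q^-1 *: y).
  by move=> r0 q0; vect_coord; field; rewrite !gt_eqF ?addr_gt0.
split=> [|x y|r x].
- by left.
- rewrite /mkset; case=> [->|[x0 Px]]; first by rewrite add0r.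
  case=> [->|[y0 Py]]; first by rewrite addr0; right; split.
  right=> /=; have xy : 0 < x.2 + y.2 by rewrite addr_gt0.
  split=> //.
  suff -> : (x.2 + y.2)^-1 *: (x.1 + y.1) = (x.2 / (x.2 + y.2)) *: (x.2^-1 *: x.1)
     + (1 - x.2 / (x.2 + y.2)) *: (y.2^-1 *: y.1).
    by apply: cP; rewrite ?divr_gt0 // ltr_pdivrMr // mul1r ltrDl.
  exact: mean.
- rewrite le_eqVlt => /predU1P[<-|r0]; first by rewrite scale0r; left.
  case=> [->|[x0 Px]]; [by left; rewrite scaler0 | right; rewrite /=].
  split; first exact: mulr_gt0.
  by rewrite scalerA invfM mulrAC mulVf ?mul1r // gt_eqF.
Qed.

(** Farkas' lemma is applied to the points [(a, 1)] and [(v, 1)]; the value of the resulting form at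
    [(0, 1)] becomes the constant term of the inequality. *)
Lemma polytope_separation (R : realType) (V : vectType R) (P : set V) (v : V) :
  is_polytope P -> ~ P v ->
  exists (c : {scalar V}) (b : R), (forall x, P x -> c x <= b) /\ b < c v.
Proof.
move=> polP nPv; have cP := polytope_convex polP.
case: polP => A /finite_seqP[s As] PA.
have sP a : a \in s -> P a.
  by move=> sa; rewrite PA; apply: sub_conv_hull; rewrite As.
have [||C Cs Cv] := @farkas R (V * R^o)%type _ [seq (a, 1 : R^o) | a <- s] (v, 1)
    (homogeneous_cone cP).
- by move=> _ /mapP[a sa ->]; right; rewrite /= invr1 scale1r; split=> //; exact: sP.
- by case=> [[_ /eqP]|[_]]; rewrite ?oner_eq0 //= invr1 scale1r.
have [|c cE] := @scalar_ex R V (fun x => C (x, 0)).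
  move=> k x y; rewrite -[RHS](linearP C).
  by congr (C (_, _)); rewrite /= scaler0 addr0.
have CE x : C (x, 1) = c x + C (0, 1).
  by rewrite cE -linearD; congr (C (_, _)); rewrite /= ?addr0 ?add0r.
exists c, (- C (0, 1)); split; last by rewrite ltrNl -subr_gt0 opprK addrC -CE.
move=> x; rewrite PA; move: x; apply: conv_hull_min; first exact: convex_halfspace.
move=> a; rewrite As => /= sa.
by rewrite -subr_le0 opprK -CE; apply: Cs; apply/mapP; exists a.
Qed.

(** Closedness along a line comes from separation: an inequality cutting off the point at [sup E]
    would already bound [E] by something smaller. *)
Lemma polytope_line_sup (R : realType) (V : vectType R) (P : set V) (u w : V)
    (E := [set r | P (u + r *: w)]) :
  is_polytope P -> E !=set0 -> has_ubound E -> E (sup E).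
Proof.
move=> polP E0 Eub; apply: contrapT => /(polytope_separation polP)[c [b [Pb]]].
rewrite linearD linearZ /= => bc.
have EP r : E r -> c u + r * c w <= b.
  by move=> /Pb; rewrite linearD linearZ.
have [r Er] := E0.
have rs : r <= sup E by exact: ub_le_sup.
have cw : 0 < c w by have := EP _ Er; nra.
have : sup E <= (b - c u) / c w.
  by apply: ge_sup => // q /EP; rewrite ler_pdivlMr // lerBrDl.
by rewrite ler_pdivlMr // lerBrDl leNgt bc.
Qed.

(* The last condition says that [v] is relatively interior to [F], i.e. that [F]
   is the smallest face containing [v]. *)
Lemma minimal_face (R : realType) (V : vectType R) (P : set V) (v : V) :
  is_polytope P -> P v -> exists F, [/\ is_face P F, F v &
    forall f, F f -> exists2 e : R, 0 < e & P (v + e *: (v - f))].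
Proof.
move=> polP Pv; have cP := polytope_convex polP.
case: polP => A /finite_seqP[s As] PA.
have sP a : a \in s -> P a.
  by move=> sa; rewrite PA; apply: sub_conv_hull; rewrite As.
have coneD := feasible_cone cP Pv.
set D := [set w | _] in coneD.
have sD : {in [seq a - v | a <- s], forall w, D w}.
  move=> _ /mapP[a sa ->]; exists 1 => //.
  by rewrite scale1r addrC subrK; exact: sP.
have halfP (c : {scalar V}) :
    {in s, forall a, c a <= c v} -> forall x, P x -> c x <= c v.
  move=> cs; rewrite PA; apply: conv_hull_min; first exact: convex_halfspace.
  by move=> a; rewrite As => /cs.
(* The form [c] is a sum of Farkas forms, one for each generator [a] with [v - a] not feasible at
   [v]. Each is maximal on [P] at [v] and strictly smaller at its [a], so every generator on the
   face of [c] has [v - a] feasible. *)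
have [c cP' cs] : exists2 c : {scalar V}, (forall x, P x -> c x <= c v) &
    {in s, forall a, D (v - a) \/ c a < c v}.
  elim: {-2}s (fun a => id : a \in s -> a \in s) => [|a l IH] ls.
    by exists \0.
  have [|c cP' cl] := IH; first by move=> x xl; apply: ls; rewrite inE xl orbT.
  have [Da|nDa] := pselect (D (v - a)).
    by exists c => // x; rewrite inE => /predU1P[->|/cl]; [left | ].
  have [c' c's] := farkas coneD sD nDa; rewrite linearB subr_gt0 /= => c'a.
  have c'P : forall x, P x -> c' x <= c' v.
    apply: halfP => x xs; rewrite -subr_le0 -linearB; apply: c's.
    by apply/mapP; exists x.
  exists (c \+ c' : {scalar V}) => [x Px|x] /=; first by rewrite lerD ?cP' ?c'P.
  rewrite inE => /predU1P[->|xl].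
    by right; rewrite ler_ltD // cP' //; apply/sP/ls; rewrite inE eqxx.
  case: (cl _ xl) => [|cx]; [by left | right].
  by rewrite ltr_leD // c'P //; apply/sP/ls; rewrite inE xl orbT.
exists (P `&` [set x | c x = c v]); split=> //; first by exists c, (c v).
move=> f; rewrite {1}PA => /conv_hull_face fA.
have : conv_hull (A `&` [set x | c x = c v]) f.
  by apply: fA => a; rewrite As => /sP /cP'.
move: f {fA}; apply: conv_hull_min.
  have [_ DD DZ] := coneD.
  apply/convex_setP=> x y t t0 t1 Dx Dy.
  have -> : v - (t *: x + (1 - t) *: y) = t *: (v - x) + (1 - t) *: (v - y).
    by vect_coord; ring.
  by apply: DD; apply: DZ => //; lra.
by move=> a [/=]; rewrite As => /= /cs[//|] => + e; rewrite e ltxx.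
Qed.

(** * Vertices and relative interior points *)

Lemma conv_hull_set0 (R : realType) (V : lmodType R) :
  conv_hull (@set0 V) = set0.
Proof.
by apply/seteqP; split=> // x; apply: (@conv_hull_min R V) => //; apply/convex_setP.
Qed.

(** The face [[set v]] lies in the hull of the generators on it; that hull is nonempty, so some
    generator lies on the face and equals [v]. *)
Lemma vert_conv_hull (R : realType) (V : lmodType R) (A : set V) :
  vert (conv_hull A) `<=` A.
Proof.
move=> v [c [b [Pb vE]]].
have [Pv cv] : (conv_hull A `&` [set x | c x = b]) v by rewrite -vE.
have : conv_hull (A `&` [set x | c x = b]) v.
  by apply: conv_hull_face => // x /sub_conv_hull /Pb.
have [[a [Aa ca]] _|/asboolPn A0] := pselect (exists a, (A `&` [set x | c x = b]) a).
  suff <- : a = v by [].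
  by have : [set v] a by rewrite vE; split=> //; exact: sub_conv_hull.
rewrite (_ : _ `&` _ = set0) ?conv_hull_set0 //.
by apply/seteqP; split=> // a Aa; case/asboolPn: A0; exists a.
Qed.

Lemma finite_vert (R : realType) (V : lmodType R) (P : set V) :
  is_polytope P -> finite_set (vert P).
Proof. by move=> [A fA ->]; apply: sub_finite_set fA; exact: vert_conv_hull. Qed.

Lemma vert_sub (R : realType) (V : lmodType R) (P : set V) : vert P `<=` P.
Proof. by move=> v /face_sub; exact. Qed.

(** Generators in the hull of the others are discarded one at a time. Once none is left, a form
    separating a generator from the hull of the others attains its maximum at that generator
    alone. *)
Lemma polytope_vert (R : realType) (V : vectType R) (P : set V) :
  is_polytope P -> P = conv_hull (vert P).
Proof.
move=> polP; apply/seteqP; split; last first.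
  exact: conv_hull_min (polytope_convex polP) (@vert_sub _ _ _).
case: polP => A /finite_seqP[s ->] ->.
have [n] := ubnP (size s); elim: n s => // n IH s sn.
have [[a as_ aP]|nP] := pselect (exists2 a, a \in s & conv_hull [set` rem a s] a).
  rewrite (_ : conv_hull [set` s] = conv_hull [set` rem a s]).
    by apply: IH; rewrite size_rem // -ltnS (leq_trans _ sn) // ltnS; case: (s) as_.
  apply/seteqP; split; last by apply: conv_hullS => x /=; exact: mem_rem.
  apply: conv_hull_min (@conv_hull_convex _ _ _) _ => x /= xs.
  have [->//|xa] := eqVneq x a.
  apply: sub_conv_hull => /=; move: xs.
  by rewrite (perm_mem (perm_to_rem as_)) inE (negbTE xa).
apply: conv_hullS => a /= as_.
have [||c [b [sb ba]]] := @polytope_separation R V (conv_hull [set` rem a s]) a.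
- by exists [set` rem a s] => //; exact: finite_seq.
- by move=> aP; apply: nP; exists a.
have cs x : x \in s -> x != a -> c x <= b.
  move=> xs xa; apply: sb; apply: sub_conv_hull => /=; move: xs.
  by rewrite (perm_mem (perm_to_rem as_)) inE (negbTE xa).
have sa x : [set` s] x -> c x <= c a.
  move=> /= xs; have [->//|xa] := eqVneq x a.
  exact: le_trans (cs _ xs xa) (ltW ba).
exists c, (c a); split.
  by apply: conv_hull_min => //; exact: convex_halfspace.
apply/seteqP; split=> [_ ->|x [xP cx]].
  by split=> //; exact: sub_conv_hull.
have : conv_hull ([set` s] `&` [set x | c x = c a]) x.
  exact: conv_hull_face.
apply: conv_hull_min => [|y [/= ys cy]]; last first.
  apply: contrapT => /eqP /(cs _ ys); rewrite cy => cab.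
  by have := lt_le_trans ba cab; rewrite ltxx.
apply/convex_setP=> _ _ t _ _ -> ->.
by rewrite /= -scalerDl addrC subrK scale1r.
Qed.

Lemma face_vert (R : realType) (V : vectType R) (P F : set V) :
  is_polytope P -> is_face P F -> F = conv_hull (vert P `&` F).
Proof.
move=> polP faceF; apply/seteqP; split; last first.
  by apply: conv_hull_min => [|x []//]; exact: convex_face (polytope_convex polP) faceF.
case: faceF => c [b [Pb ->]] x [Px cx].
have : conv_hull (vert P `&` [set x | c x = b]) x.
  apply: conv_hull_face => [y /vert_sub /Pb //|].
  by rewrite -polytope_vert.
by apply: conv_hullS => y [vy cy]; split=> //; split=> //; exact: vert_sub.
Qed.

Lemma is_polytope_conv (R : realType) (V : lmodType R) (A : set V) :
  finite_set A -> is_polytope (conv_hull A).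
Proof. by move=> fA; exists A. Qed.

(** It suffices to be able to move away from each generator, since feasible directions form a convex
    cone; averaging with the generators one after the other achieves this. *)
Lemma polytope_relint (R : realType) (V : vectType R) (P : set V) :
  is_polytope P -> P !=set0 -> exists2 v, P v &
    forall f, P f -> exists2 e : R, 0 < e & P (v + e *: (v - f)).
Proof.
move=> polP [x Px]; have cP := polytope_convex polP.
case: polP => A /finite_seqP[s As] PA.
have sP : {in s, forall a, P a}.
  by move=> a sa; rewrite PA; apply: sub_conv_hull; rewrite As.
have [v Pv vs] : exists2 v, P v &
    {in s, forall a, exists2 e : R, 0 < e & P (v + e *: (v - a))}.
  elim: s {As} sP => [|a s IH] sP; first by exists x.
  have [|v Pv vs] := IH; first by move=> b bs; apply: sP; rewrite inE bs orbT.
  have Pa : P a by apply: sP; rewrite inE eqxx.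
  move/convex_setP: cP => cP.
  (* From the midpoint of [v] and [a], moving away from [a] by step 1 leads back to [v]; a step [e]
     available from [v] away from an earlier [b] shrinks to [e / (2 + e)]. *)
  exists (2^-1 *: v + (1 - 2^-1) *: a); first by apply: cP => //; lra.
  move=> b; rewrite inE => /predU1P[->|/vs[e e0 Pe]].
    exists 1 => //; set w := (X in P X); suff -> : w = v by [].
    by rewrite /w; vect_coord; field.
  have e2 : 0 < 2 + e by lra.
  exists (e / (2 + e)); first by rewrite divr_gt0.
  set w := (X in P X).
  have -> : w = (2 + e)^-1 *: (v + e *: (v - b)) + (1 - (2 + e)^-1) *: a.
    by rewrite /w; vect_coord; field; rewrite gt_eqF.
  by apply: cP => //; rewrite ?invr_gt0 // invf_lt1 //; lra.
exists v => // f; rewrite {1}PA; move: f; apply: conv_hull_min; last first.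
  by move=> a; rewrite As => /vs.
have [_ DD DZ] := feasible_cone cP Pv.
apply/convex_setP=> y z t t0 t1 Dy Dz; rewrite /=.
have -> : v - (t *: y + (1 - t) *: z) = t *: (v - y) + (1 - t) *: (v - z).
  by vect_coord; ring.
by apply: DD; apply: DZ => //; lra.
Qed.

(** * The two implications *)

(** Only the inclusion that uses the PF-property is treated here; the reverse one is a matter of
    convexity. *)
Lemma fiber_conv (R : realType) (V U : vectType R) (f : {linear V -> U})
    (P : set V) (S : set U) : is_polytope P ->
    (forall F, is_face P F -> is_face (f @` P) (f @` F)) ->
    S `<=` vert (f @` P) ->
  f @^-1` conv_hull S `&` P `<=` conv_hull (f @^-1` S `&` vert P).
Proof.
move=> polP PF SQ v [Sfv Pv]; apply: contrapT => nWv.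
set W := f @^-1` S `&` vert P in nWv.
have polW : is_polytope (conv_hull W).
  by exists W => //; apply: sub_finite_set (finite_vert polP) => ? [].
have [c [b [Wb bv]]] := polytope_separation polW nWv.
(* Among the points of [P] above [f v], choose [u] maximizing [c]. *)
have [u [Pu fu cu umax]] : exists u, [/\ P u, f u = f v, c v <= c u &
    forall w, P w -> f w = f v -> c w <= c u].
  have [g gE] : exists g : {linear V -> (U * R^o)%type}, forall x, g x = (f x, c x).
    pose g x : (U * R^o)%type := (f x, c x).
    have lg : linear g by move=> k x y; rewrite /g !linearP.
    pose m := GRing.isLinear.Build R V (U * R^o)%type *:%R _ lg.
    by exists (HB.pack_for {linear V -> (U * R^o)%type} g m).
  have gline r x : g x = (f v, 0) + r *: (0, 1 : R^o) <-> f x = f v /\ c x = r.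
    have -> : (f v, 0) + r *: (0, 1 : R^o) = (f v, r).
      apply: injective_projections; rewrite /= ?scaler0 ?addr0 //.
      by rewrite add0r [_ *: _]mulr1.
    by rewrite gE; split=> [[-> ->]|[-> ->]].
  pose E := [set r | (g @` P) ((f v, 0) + r *: (0, 1 : R^o))].
  have Ev w : P w -> f w = f v -> E (c w).
    by move=> Pw fw; exists w => //; apply/gline.
  have [M PM] := polytope_bounded c polP.
  have ubE : has_ubound E.
    by exists M => r [w Pw /gline[_ <-]]; exact: PM.
  have [] := @polytope_line_sup R (U * R^o)%type _ _ _ (polytope_image g polP) _ ubE.
    by exists (c v); exact: Ev.
  move=> u Pu /gline[fu cu]; exists u; rewrite cu; split=> //.
    by apply: ub_le_sup => //; exact: Ev.
  by move=> w Pw fw; apply: ub_le_sup => //; exact: Ev.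
have [F [faceF Fu relF]] := minimal_face polP Pu.
have cF := convex_face (polytope_convex polP) faceF.
(* The form exposing the vertex [t] of the image, composed with [f], cuts out the part of [P] above
   [t] as a face; the vertices of that face belong to [W]. *)
have SF : S `&` (f @` F) `<=` f @` (F `&` conv_hull W).
  move=> t [St [w Fw fwt]]; exists w => //; split=> //.
  have Sfw : S (f w) by rewrite fwt.
  have [d [k [Qk fwE]]] := SQ _ Sfw.
  have QP x : P x -> (d \o f) x <= k by move=> Px; apply: Qk; exists x.
  have : conv_hull (vert P `&` [set x | (d \o f) x = k]) w.
    apply: (@conv_hull_face _ _ _ (d \o f : {scalar V})).
      by move=> x /vert_sub /QP.
    rewrite -polytope_vert //; split; first exact: face_sub faceF _ Fw.
    by have : [set f w] (f w) by []; rewrite {1}fwE => -[].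
  apply: conv_hullS => x [vx dx]; split=> //.
  suff : [set f w] (f x) by rewrite /= => ->.
  by rewrite fwE; split=> //; exists x => //; exact: vert_sub.
have [w [Fw Ww] fw] : (f @` (F `&` conv_hull W)) (f v).
  have : conv_hull (S `&` (f @` F)) (f v).
    have := PF _ faceF; case=> d [k [Qk FE]].
    have : (f @` F) (f v) by exists u.
    rewrite FE => -[Qv dv]; have : conv_hull (S `&` [set x | d x = k]) (f v).
      by apply: conv_hull_face => // x /SQ /vert_sub /Qk.
    apply: conv_hullS => x [Sx dx]; split=> //; split=> //.
    by apply: vert_sub; exact: SQ.
  move: (f v); apply: conv_hull_min SF.
  by apply/convex_image/convexI => //; exact: conv_hull_convex.
(* Since [c w <= b < c v <= c u], the move from [u] away from [w] raises [c] above its maximum on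
   the fibre. *)
have [e e0 Pe] := relF _ Fw.
have fe : f (u + e *: (u - w)) = f v.
  by rewrite linearD linearZ linearB /= fu fw subrr scaler0 addr0.
have := umax _ Pe fe; rewrite linearD linearZ linearB /=.
by have := Wb _ Ww; nra.
Qed.

Lemma face_image (R : realType) (V U : vectType R) (f : {linear V -> U})
    (P F : set V) : is_polytope P ->
    (forall S, S `<=` vert (f @` P) ->
      f @^-1` conv_hull S `&` P `<=` conv_hull (f @^-1` S `&` vert P)) ->
  is_face P F -> is_face (f @` P) (f @` F).
Proof.
move=> polP fib faceF.
have polF : is_polytope F.
  rewrite (face_vert polP faceF); apply: is_polytope_conv.
  by apply: sub_finite_set (finite_vert polP) => ? [].
have [F0|F0] := pselect (F !=set0); last first.
  have -> : f @` F = set0.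
    by apply/seteqP; split=> // z [x Fx _]; apply: F0; exists x.
  exists \0, 1; split=> [x _|]; first exact: ler01.
  by apply/seteqP; split=> // x [_ /= e]; have := @oner_neq0 R; rewrite -e eqxx.
have polQ := polytope_image f polP; set Q := f @` P in polQ fib *.
have cF := convex_face (polytope_convex polP) faceF.
have [y Fy relF] := polytope_relint polF F0.
have Py := face_sub faceF Fy.
have Qy : Q (f y) by exists y.
have [G [faceG Gy relG]] := minimal_face polQ Qy.
suff -> : f @` F = G by [].
apply/seteqP; split=> [_ [z Fz <-]|].
  have [e e0 Fe] := relF _ Fz.
  apply: face_extremal faceG Gy _ e0 _.
    by exists z => //; exact: face_sub faceF _ Fz.
  exists (y + e *: (y - z)); first exact: face_sub faceF _ Fe.
  by rewrite linearD linearZ linearB.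
rewrite (face_vert polQ faceG); apply: conv_hull_min; first exact: convex_image.
move=> t [vt Gt]; apply: contrapT => nFt.
have Qt := vert_sub vt.
have [e e0 Qe] := relG _ Gt.
(* Leave [Q] along the line from [t] through [f y]: the smallest face [H]
   containing the exit point contains neither [t] nor [f y]. *)
pose E := [set r | Q (f y + r *: (f y - t))].
(* The form exposing [t] is strictly smaller at [f y], which differs from [t], so it decreases along
   the line; a bound for its negative on [Q] then bounds [E]. *)
have ubE : has_ubound E.
  have [c [b [Qb tE]]] := vt.
  have [_ ct] : (Q `&` [set x | c x = b]) t by rewrite -tE.
  have cy : c (f y) < c t.
    rewrite lt_neqAle ct Qb // andbT; apply/eqP => cy; apply: nFt.
    have fyt : [set t] (f y) by rewrite tE.
    by exists y.
  have [M QM] := polytope_bounded (\- c : {scalar U}) polQ.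
  exists ((M + c (f y)) / (c t - c (f y))) => r /QM /=.
  by rewrite linearD linearZ linearB /= ler_pdivlMr ?subr_gt0 //; lra.
have sE := polytope_line_sup polQ (ex_intro _ e Qe) ubE.
set s := sup _ in sE.
have s0 : 0 < s by apply: lt_le_trans e0 _; exact: ub_le_sup.
have [H [faceH Hz relH]] := minimal_face polQ sE.
have nHt : ~ H t.
  (* A move by [d] from the exit point away from [t] would reach the parameter [s + d + d * s],
     which exceeds [s]. *)
  move=> /relH[d d0]; set w := (X in Q X).
  have -> : w = f y + (s + d + d * s) *: (f y - t).
    by rewrite /w; vect_coord; ring.
  move=> /(ub_le_sup ubE); rewrite -/s; nra.
have nHy : ~ H (f y).
  by move=> Hy; apply: nHt; exact: face_extremal faceH Hy Qt s0 sE.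
pose S := t |` (vert Q `&` H).
have SQ : S `<=` vert Q by move=> x [->//|[]].
have Sy : conv_hull S (f y).
  (* Weight [(1 + s)^-1] on the exit point and the rest on [t] give back [f y]. *)
  have /convex_setP := @conv_hull_convex _ _ S.
  move=> /(_ (f y + s *: (f y - t)) t (1 + s)^-1).
  have -> : (1 + s)^-1 *: (f y + s *: (f y - t)) + (1 - (1 + s)^-1) *: t = f y.
    by vect_coord; field; rewrite gt_eqF // addr_gt0.
  apply; rewrite ?invr_gt0 ?invf_lt1 ?addr_gt0 ?ltrDl //.
    have : conv_hull (vert Q `&` H) (f y + s *: (f y - t)) by rewrite -face_vert.
    by apply: conv_hullS => x; right.
  by apply: sub_conv_hull; left.
have Wy := fib _ SQ _ (conj Sy Py).
apply: nHy.
have cH := convex_face (polytope_convex polQ) faceH.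
case: (faceF) => c [b [Pb FE]].
have : conv_hull (f @^-1` S `&` vert P `&` [set x | c x = b]) y.
  apply: conv_hull_face => [x [_ /vert_sub /Pb]//|].
  by split=> //; move: Fy; rewrite FE => -[].
(* No vertex of [F] maps to [t], so those above [S] all map into [H], and [y], being in their hull,
   does too. *)
suff : f @^-1` S `&` vert P `&` [set x | c x = b] `<=` f @^-1` H.
  by move=> sub; exact: (conv_hull_min (convex_preimage cH) sub).
move=> x [[[fx|[]//] vx] cx]; case: nFt; exists x => //.
by rewrite FE; split=> //; exact: vert_sub.
Qed.

Theorem theorem5 (R : realType) (n d : nat) (P : set ('rV[R]_n * 'rV[R]_d))
    (polP : is_polytope P) :
  (PF_property P <->
     forall S : set 'rV[R]_n, S `<=` vert (p_x @` P) ->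
       conv_hull [set v | vert P v /\ S (p_x v)] =
       [set v | P v /\ conv_hull S (p_x v)]) /\
  (PF_property P <->
     forall S : set 'rV[R]_n, S `<=` vert (p_x @` P) ->
       p_x @^-1` conv_hull S `&` P = conv_hull (p_x @^-1` S `&` vert P)).
Proof.
(* The plain function [p_x] is convertible to [fst], whose linear structure makes the general lemmas
   applicable. *)
pose f : {linear ('rV[R]_n * 'rV[R]_d)%type -> 'rV[R]_n} := fst.
have PFP : PF_property P <-> forall S : set 'rV[R]_n, S `<=` vert (p_x @` P) ->
    p_x @^-1` conv_hull S `&` P = conv_hull (p_x @^-1` S `&` vert P).
  split=> [PF S SQ|fib F].
    apply/seteqP; split; first exact: (@fiber_conv R _ _ f).
    apply: conv_hull_min => [|x [Sx vx]].
      apply: convexI (polytope_convex polP).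
      exact: (@convex_preimage _ _ _ f) (@conv_hull_convex _ _ _).
    by split; [exact: sub_conv_hull | exact: vert_sub].
  apply: (@face_image R _ _ f) => // S SQ.
  by rewrite -[X in _ `<=` X]fib.
split=> //; rewrite PFP.
have fibE (S : set 'rV[R]_n) :
    [set v | P v /\ conv_hull S (p_x v)] = p_x @^-1` conv_hull S `&` P /\
    [set v | vert P v /\ S (p_x v)] = p_x @^-1` S `&` vert P.
  by split; apply/seteqP; split=> v [].
by split=> fib S SQ; have := fib S SQ; have [-> ->] := fibE S.
Qed.
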